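(* Let $T>0$, $n,m,k\ge1$, $0=t_0<t_1<\dots<t_m=T$, let $A$ be a continuous $(n\times n)$-matrix function on $[0,T]$, $K(t,\tau)$ a continuous $(n\times n)$-matrix function on $[0,T]\times[0,T]$, $B_0,\dots,B_m$ constant $(n\times n)$ matrices, $f\in C([0,T],\mathbb R^n)$ and $d\in\mathbb R^n$. Let $\varepsilon>0$ and let $\varphi_j,\psi_j$ ($j=1,\dots,k$) be continuous $(n\times n)$-matrix functions on $[0,T]$ with $$\max_{t\in[0,T]}\int_0^T\Big\|K(t,\tau)-\sum_{j=1}^k\varphi_j(t)\psi_j(\tau)\Big\|\,d\tau<\varepsilon .$$ Suppose that the $\varepsilon$-approximating problem $$\frac{dx}{dt}=A(t)x+\sum_{j=1}^k\int_0^T\varphi_j(t)\psi_j(\tau)x(\tau)\,d\tau+f(t),\quad t\in(0,T),\qquad \sum_{i=0}^mB_ix(t_i)=d \qquad (\mathrm{P}_\varepsilon)$$ is well-posed with constant $C_k$ and that $$q_k^{\varepsilon}:=C_k\cdot\varepsilon<1 .$$ Let $x^{(0)}$ be the solution of $(\mathrm{P}_\varepsilon)$ and, for $i=1,2,\dots$, let $x^{(i)}$ be the unique solution of the problem $$\frac{dx}{dt}=A(t)x+\sum_{j=1}^k\varphi_j(t)\int_0^T\psi_j(\tau)x(\tau)\,d\tau+f(t)+\int_0^T\Big[K(t,\tau)-\sum_{j=1}^k\varphi_j(t)\psi_j(\tau)\Big]x^{(i-1)}(\tau)\,d\tau,\quad t\in(0,T),\qquad \sum_{l=0}^mB_lx(t_l)=d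 .$$ Then the problem $$\frac{dx}{dt}=A(t)x+\int_0^TK(t,\tau)x(\tau)\,d\tau+f(t),\quad t\in(0,T),\qquad \sum_{i=0}^mB_ix(t_i)=d$$ has a unique solution $x^\ast$, the sequence $(x^{(i)})$ converges to $x^\ast$ in $\|\cdot\|_1$, and for $i=1,2,\dots$ $$\|x^\ast-x^{(i)}\|_1\le\frac{1}{1-q_k^{\varepsilon}}\,(q_k^{\varepsilon})^{i}\,C_k\max(\|f\|_1,\|d\|).$$
   Context: Norms: $\|x\|=\max_i|x_i|$ on $\mathbb R^n$, matrices carry the induced operator norm, $\|x\|_1=\max_{t\in[0,T]}\|x(t)\|$ for $x\in C([0,T],\mathbb R^n)$. A solution of any of these problems is a function $x:[0,T]\to\mathbb R^n$ that is continuous on $[0,T]$, continuously differentiable on $(0,T)$, and satisfies the integro-differential equation on $(0,T)$ and the multipoint condition. Problem $(\mathrm P_\varepsilon)$ is well-posed with constant $C_k$ if for every pair $(f,d)$ with $f\in C([0,T],\mathbb R^n)$, $d\in\mathbb R^n$ (with $A,\varphi_j,\psi_j,B_i,t_i$ fixed) it has a unique solution $x$, and $\|x\|_1\le C_k\max(\|f\|_1,\|d\|)$, where $C_k$ is independent of $f$ and $d$. *)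

(* Defs.v *)
From HB Require Import structures.
From mathcomp Require Import all_boot all_order all_algebra.
From mathcomp Require Import all_classical all_reals all_analysis.

Set Implicit Arguments.
Unset Strict Implicit.
Unset Printing Implicit Defensive.

Import Order.TTheory GRing.Theory Num.Theory.
Import numFieldNormedType.Exports.

Local Open Scope classical_set_scope.
Local Open Scope ring_scope.

(* The library norm `|v| of v : 'cV[R]_n is max_i |v_i|.  The library norm of a
   square matrix is the largest absolute value of an entry, so the operator norm
   induced by the norm of 'cV[R]_n is defined separately. *)
Definition opnorm (R : realType) (n : nat) (M : 'M[R]_n) : R :=
  sup [set `|M *m v| | v in [set v : 'cV[R]_n | `|v| <= 1]].

(* Only used for functions g that are continuous on [0, T], where the supremum
   is a maximum; [sup] is 0 by convention on unbounded or empty sets. *)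
Definition maxT (R : realType) (T : R) (g : R -> R) : R :=
  sup [set g s | s in `[0, T]].

(* Functions on [0, T] are represented by total functions, whose values outside
   of [0, T] are irrelevant. *)
Definition norm1 (R : realType) (n : nat) (T : R) (x : R -> 'cV[R]_n) : R :=
  maxT T (fun s => `|x s|).

Definition cintegral (R : realType) (n : nat) (T : R) (g : R -> 'cV[R]_n) :
    'cV[R]_n :=
  \col_i \int[lebesgue_measure]_(tau in `[0, T]) g tau i ord0.

Section problems.
Context (R : realType) (n m k : nat) (T : R).
Context (A : R -> 'M[R]_n) (K : R -> R -> 'M[R]_n).
Context (phi psi : 'I_k -> R -> 'M[R]_n).
Context (t : 'I_m.+1 -> R) (B : 'I_m.+1 -> 'M[R]_n).
Implicit Types (f g x : R -> 'cV[R]_n) (d : 'cV[R]_n).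

(* x solves  x' = A x + L x + f on (0, T),  sum_i B_i x(t_i) = d. *)
Definition solution_with (L : (R -> 'cV[R]_n) -> R -> 'cV[R]_n) f d x : Prop :=
  [/\ {within `[0, T], continuous x},
      forall s, s \in `]0, T[ -> derivable x s 1,
      {within `]0, T[, continuous derive1 x},
      forall s, s \in `]0, T[ -> derive1 x s = A s *m x s + L x s + f s &
      \sum_(i < m.+1) B i *m x (t i) = d].

Definition degenerate_kernel (s tau : R) : 'M[R]_n :=
  \sum_(j < k) phi j s *m psi j tau.

Definition exact_solution f d x : Prop :=
  solution_with (fun y s => cintegral T (fun tau => K s tau *m y tau)) f d x.

Definition approx_solution f d x : Prop :=
  solution_with
    (fun y s => \sum_(j < k)
                  cintegral T (fun tau => phi j s *m psi j tau *m y tau))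
    f d x.

(* The problem for x^(i), where xprev stands for x^(i-1). *)
Definition step_solution f d xprev x : Prop :=
  solution_with
    (fun y s => \sum_(j < k)
                  phi j s *m cintegral T (fun tau => psi j tau *m y tau))
    (fun s => f s +
       cintegral T (fun tau => (K s tau - degenerate_kernel s tau) *m xprev tau))
    d x.

Definition unique_solution (P : (R -> 'cV[R]_n) -> Prop) x : Prop :=
  P x /\ forall y, P y -> forall s, s \in `[0, T] -> y s = x s.

Definition well_posed (C : R) : Prop :=
  forall f d, {within `[0, T], continuous f} ->
    exists x, unique_solution (approx_solution f d) x /\
              norm1 T x <= C * Num.max (norm1 T f) `|d|.

Definition successive_approximations f d (xs : nat -> R -> 'cV[R]_n) : Prop :=
  unique_solution (approx_solution f d) (xs 0%N) /\
  forall i, unique_solution (step_solution f d (xs i)) (xs i.+1).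

End problems.

(* Main.v *)
(* Let S be the integral operator whose kernel is the difference between K and
   the degenerate kernel; its norm on C[0, T] is at most eps.  An exact solution
   for f is a fixed point of the map G sending y to the solution of (P_eps) with
   right-hand side f + S y, and the successive approximations are the iterates
   of G.  Differences of solutions of (P_eps) solve (P_eps) for the differences
   of the data, so well-posedness makes G a contraction of ratio q = C eps.
   The uniform limit x of the iterates is not differentiated: it agrees on
   [0, T] with G x, which is a solution by definition of G.  For the estimate,
   |x0 - x*| <= q |x*| gives |x0 - x*| <= q / (1 - q) |x0|. *)
Require Import Defs.
From HB Require Import structures.
From mathcomp Require Import all_boot all_order all_algebra.
From mathcomp Require Import all_classical all_reals all_analysis.
From mathcomp Require Import ring lra.

Set Implicit Arguments.
Unset Strict Implicit.
Unset Printing Implicit Defensive.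

Import Order.TTheory GRing.Theory Num.Theory.
Import numFieldNormedType.Exports.

Local Open Scope classical_set_scope.
Local Open Scope ring_scope.

(** * Entrywise norm and continuity of matrix functions *)

Lemma mx_norm_leP (R : realType) (p q : nat) (M : 'M[R]_(p, q)) (e : R) :
  0 <= e -> (forall i j, `|M i j| <= e) <-> `|M| <= e.
Proof.
move=> e0; split=> [Me|Me i j].
  rewrite /Num.Def.normr/= mx_normrE.
  by apply: bigmax_le => // -[i j] _; exact: Me.
apply: le_trans Me; rewrite [leRHS]/Num.Def.normr/= mx_normrE.
exact: (le_bigmax _ (fun ij : 'I_p * 'I_q => `|M ij.1 ij.2|) (i, j)).
Qed.

Lemma ler_mx_norm_entry (R : realType) (p q : nat) (M : 'M[R]_(p, q)) i j :
  `|M i j| <= `|M|.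
Proof. exact: ((mx_norm_leP M (normr_ge0 M)).2 (lexx _)). Qed.

(** There are finitely many entries, so their neighbourhoods intersect in a neighbourhood; this
    reduces vector statements to scalar ones. *)
Lemma continuous_mxP (R : realType) (X : topologicalType) (p q : nat)
    (f : X -> 'M[R]_(p, q)) :
  continuous f <-> forall i j, continuous (fun x => f x i j : R).
Proof.
split=> [cf i j x|cf x].
  apply/cvgrPdist_le => e e0; move/cvgrPdist_le : (cf x) => /(_ _ e0).
  apply: filterS => y; apply: le_trans.
  by apply: le_trans (ler_mx_norm_entry _ i j); rewrite !mxE.
apply/cvgrPdist_le => e e0; near=> y.
apply/mx_norm_leP => [|i j]; first exact: ltW.
rewrite !mxE; move: i j; near: y.
apply: filter_forall => i; apply: filter_forall => j.
exact: ((cvgrPdist_le _ _).1 (cf i j x)).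
Unshelve. all: by end_near. Qed.

Lemma continuous_mulmx (R : realType) (X : topologicalType) (p q r : nat)
    (f : X -> 'M[R]_(p, q)) (g : X -> 'M[R]_(q, r)) :
  continuous f -> continuous g -> continuous (fun x => f x *m g x).
Proof.
move=> /continuous_mxP cf /continuous_mxP cg; apply/continuous_mxP => i j.
under eq_fun do rewrite mxE.
apply: continuous_big => [|l _ x]; first exact: add_continuous.
by apply: cvgM; [exact: cf|exact: cg].
Qed.

(** Each entry of the product is a sum of [n] terms, each at most [|M| * |v|]. *)
Lemma ler_norm_mulmx (R : realType) (n : nat) (M : 'M[R]_n) (v : 'cV[R]_n) :
  `|M *m v| <= n%:R * `|M| * `|v|.
Proof.
apply/mx_norm_leP => [|i j]; first by rewrite !mulr_ge0.
rewrite mxE; apply: le_trans (ler_norm_sum _ _ _) _.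
rewrite -mulrA mulr_natl -[in X in _ *+ X](card_ord n) -sumr_const.
by apply: ler_sum => l _; rewrite normrM ler_pM ?ler_mx_norm_entry.
Qed.

(** * The induced operator norm *)

Section operator_norm.
Context (R : realType) (n : nat).
Implicit Types (M N : 'M[R]_n) (v : 'cV[R]_n).

(** The set under [sup] is bounded by [n |M|], so [opnorm] is a genuine supremum and not the default
    0. *)
Lemma opnorm_ub M v : `|v| <= 1 -> `|M *m v| <= opnorm M.
Proof.
move=> v1; apply: ub_le_sup; last by exists v.
exists (n%:R * `|M|) => _ [w /= w1 <-].
by apply: le_trans (ler_norm_mulmx _ _) _; rewrite ler_piMr ?mulr_ge0.
Qed.

Lemma opnorm_le M c : (forall v, `|v| <= 1 -> `|M *m v| <= c) -> opnorm M <= c.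
Proof.
move=> Mc; apply: ge_sup => [|_ [v /= v1 <-]]; last exact: Mc.
by exists `|M *m (0 : 'cV[R]_n)|, 0 => //=; rewrite normr0.
Qed.

Lemma ler_opnorm_mulmx M v : `|M *m v| <= opnorm M * `|v|.
Proof.
have [->|v0] := eqVneq v 0; first by rewrite mulmx0 !normr0 mulr0.
have v_gt0 : 0 < `|v| by rewrite normr_gt0.
have := opnorm_ub M (v := `|v|^-1 *: v).
rewrite -scalemxAr !normrZ normfV normr_id mulVf ?gt_eqF// => /(_ (lexx _)).
by rewrite mulrC ler_pdivrMr.
Qed.

Lemma opnorm_ge0 M : 0 <= opnorm M.
Proof. by apply: le_trans (opnorm_ub M (v := 0) _); rewrite ?normr0. Qed.

Lemma opnorm_le_norm M : opnorm M <= n%:R * `|M|.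
Proof.
apply: opnorm_le => v v1.
by apply: le_trans (ler_norm_mulmx _ _) _; rewrite ler_piMr ?mulr_ge0.
Qed.

Lemma ler_opnormD M N : opnorm (M + N) <= opnorm M + opnorm N.
Proof.
apply: opnorm_le => v v1; rewrite mulmxDl.
by apply: le_trans (ler_normD _ _) _; rewrite lerD ?opnorm_ub.
Qed.

(** By subadditivity, [opnorm] is Lipschitz with constant [n] for the entrywise norm. *)
Lemma continuous_opnorm (X : topologicalType) (f : X -> 'M[R]_n) :
  continuous f -> continuous (fun x => opnorm (f x)).
Proof.
move=> cf.
have lip M N : opnorm M - opnorm N <= n%:R * `|M - N|.
  have := ler_opnormD (M - N) N; rewrite subrK lerBlDr => /le_trans; apply.
  by rewrite lerD2r opnorm_le_norm.
move=> x; apply/cvgrPdist_le => e e0.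
(* The [+ 1] keeps the divisor positive when [n] is 0. *)
have d0 : 0 < e / (n%:R + 1) by rewrite divr_gt0// ltr_wpDl.
move/cvgrPdist_le : (cf x) => /(_ _ d0); apply: filterS => y.
rewrite ler_pdivlMr ?ltr_wpDl// mulrC => fxy.
have {}fxy : n%:R * `|f x - f y| <= e.
  by apply: le_trans fxy; rewrite ler_wpM2r// lerDl.
rewrite ler_norml lerNl opprB.
by rewrite (le_trans (lip _ _))/= ?(le_trans (lip _ _))// distrC.
Qed.

End operator_norm.

(** Transfers continuity between the segment and the square, along slices and coordinate
    projections. *)
Lemma within_continuous_comp (X Y Z : topologicalType) (A : set X) (B : set Y)
    (g : X -> Y) (h : Y -> Z) :
  (forall x, A x -> B (g x)) ->
  {within A, continuous g} -> {within B, continuous h} ->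
  {within A, continuous (fun x => h (g x))}.
Proof.
move=> AB /subspace_continuousP cg /subspace_continuousP ch.
apply/subspace_continuousP => x Ax.
apply: (@cvg_comp _ _ _ g h _ (within B (nbhs (g x)))); last first.
  exact: ch (AB _ Ax).
move=> U /(cg _ Ax) /=; rewrite !nbhs_simpl /within /=.
apply: filterS => y hy Ay.
exact: hy (AB _ Ay).
Qed.

(** * Integrals over [0, T], scalar and vector valued, with parameters *)

Section integral_on_segment.
Context (R : realType) (T : R) (T_gt0 : 0 < T).
Notation I := (`[0, T]%classic : set R).
Notation mu := (@lebesgue_measure R).

Lemma continuous_slice (Z : topologicalType) (H : R -> R -> Z) s :
  {within I `*` I, continuous (fun p => H p.1 p.2)} -> I s ->
  {within I, continuous (H s)}.
Proof.
move=> cH Is.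
apply: (within_continuous_comp (g := fun tau => (s, tau)) _ _ cH) => //.
apply: continuous_subspaceT => tau.
by apply: (@cvg_pair _ _ _ _ (nbhs s) (nbhs tau) _ _ _ (cst s) id);
  [exact: cvg_cst|exact: cvg_id].
Qed.

Lemma continuous_fst (Z : topologicalType) (y : R -> Z) :
  {within I, continuous y} -> {within I `*` I, continuous (fun p => y p.1)}.
Proof.
apply: (within_continuous_comp (g := fst)) => [[? ?] []//|].
by apply: continuous_subspaceT => -[a b]; exact: cvg_fst.
Qed.

Lemma continuous_snd (Z : topologicalType) (y : R -> Z) :
  {within I, continuous y} -> {within I `*` I, continuous (fun p => y p.2)}.
Proof.
apply: (within_continuous_comp (g := snd)) => [[? ?] []//|].
by apply: continuous_subspaceT => -[a b]; exact: cvg_snd.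
Qed.

Lemma continuous_integrable (g : R -> R) :
  {within I, continuous g} -> mu.-integrable I (EFin \o g).
Proof. by apply: continuous_compact_integrable; exact: segment_compact. Qed.

Lemma Rintegral_continuous_sum (J : finType) (F : J -> R -> R) :
  (forall j, {within I, continuous (F j)}) ->
  \int[mu]_(s in I) (\sum_j F j s) = \sum_j \int[mu]_(s in I) F j s.
Proof.
move=> cF; have iF j := continuous_integrable (cF j).
rewrite /Rintegral sum_fine => [|j _]; last first.
  by apply: integrable_fin_num => //; exact: iF.
rewrite -integral_sum => [|//|j]; last exact: iF.
congr fine; apply: eq_integral => s _.
by rewrite sumEFin.
Qed.

(** Compactness of the segment makes continuity in the parameter uniform in [tau]; a uniform error
    [e / T] integrates to at most [e]. *)
Lemma continuous_Rintegral (H : R -> R -> R) :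
  {within I `*` I, continuous (fun p => H p.1 p.2)} ->
  {within I, continuous (fun s => \int[mu]_(tau in I) H s tau)}.
Proof.
move=> cH; apply/subspace_continuousP => s Is.
apply/cvgrPdist_le => e e0.
have : \forall s' \near within I (nbhs s),
    forall tau, I tau -> `|H s tau - H s' tau| <= e / T.
  have /compact_near_coveringP/near_covering_withinP := @segment_compact _ 0 T.
  apply => tau Itau.
  move/subspace_continuousP : (cH) => /(_ (s, tau) (conj Is Itau)).
  move/cvgrPdist_le => /(_ (e / T / 2)); rewrite !divr_gt0// => /(_ isT).
  case=> -[/= U V] [Us Vtau] UVP.
  exists (V, fun s' => I s' /\ U s') => /=.
    split=> //; rewrite /within/=.
    by apply: filterS Us => s' Us' Is'.
  case=> tau' s' [/= Vtau' [Is' Us']] Itau'.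
  (* Continuity is known at [(s, tau)] only, so both values at [tau'] are compared with [H s tau],
     each at the cost of half of [e / T]. *)
  have /= H1 := UVP (s, tau') (conj (nbhs_singleton Us) Vtau') (conj Is Itau').
  have /= H2 := UVP (s', tau') (conj Us' Vtau') (conj Is' Itau').
  rewrite [e / T]splitr (le_trans (ler_distD (H s tau) _ _))// lerD//.
  by rewrite distrC.
have IT : fine (mu I) = T by rewrite lebesgue_measure_itv/= lte_fin T_gt0 sube0.
move=> near_s; near=> s'.
have Is' : I s' by near: s'; exact: withinT.
have cHB : {within I, continuous (fun tau => H s tau - H s' tau)}.
  by move=> tau; apply: cvgB; exact: continuous_slice.
rewrite -RintegralB//;
  try by apply: continuous_integrable; exact: continuous_slice.
(* The bound [e] is rewritten as the integral of the constant [e / T]. *)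
rewrite -[leRHS](divfK (lt0r_neq0 T_gt0)) -[X in _ * X]IT -Rintegral_cst//.
apply: le_trans (le_normr_Rintegral _ (continuous_integrable cHB)) _ => //.
apply: le_Rintegral => //; last by near: s'.
  by apply: continuous_integrable => tau; apply: cvg_norm; exact: cHB.
by apply: continuous_integrable => tau; exact: cvg_cst.
Unshelve. all: by end_near. Qed.

Section vector_valued.
Context (n : nat).
Implicit Types (g h : R -> 'cV[R]_n).

Lemma continuous_entry_integrable g i : {within I, continuous g} ->
  mu.-integrable I (EFin \o (fun tau => g tau i ord0)).
Proof.
by move=> /continuous_mxP cg; apply: continuous_integrable; exact: cg.
Qed.

Lemma eq_cintegral g h : {in I, g =1 h} -> cintegral T g = cintegral T h.
Proof.
move=> gh; apply/colP => i; rewrite !mxE.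
by apply: eq_Rintegral => s Is; rewrite gh.
Qed.

Lemma cintegralD g h :
  {within I, continuous g} -> {within I, continuous h} ->
  cintegral T (fun s => g s + h s) = cintegral T g + cintegral T h.
Proof.
move=> cg ch; apply/colP => i; rewrite !mxE.
rewrite -RintegralD//; try exact: continuous_entry_integrable.
by apply: eq_Rintegral => s Is; rewrite mxE.
Qed.

Lemma cintegralB g h :
  {within I, continuous g} -> {within I, continuous h} ->
  cintegral T (fun s => g s - h s) = cintegral T g - cintegral T h.
Proof.
move=> cg ch; apply/colP => i; rewrite !mxE.
rewrite -RintegralB//; try exact: continuous_entry_integrable.
by apply: eq_Rintegral => s Is; rewrite !mxE.
Qed.

Lemma cintegral_mulmx (M : 'M[R]_n) g :
  {within I, continuous g} ->
  cintegral T (fun s => M *m g s) = M *m cintegral T g.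
Proof.
move=> cg; apply/colP => i; rewrite !mxE.
under eq_Rintegral do rewrite mxE.
rewrite Rintegral_continuous_sum => [|j s]; last first.
  by apply: cvgM; [exact: cvg_cst|move/continuous_mxP : cg; exact].
apply: eq_bigr => j _; rewrite mxE RintegralZl//.
exact: continuous_entry_integrable.
Qed.

Lemma cintegral_sum (J : finType) (G : J -> R -> 'cV[R]_n) :
  (forall j, {within I, continuous (G j)}) ->
  cintegral T (fun s => \sum_j G j s) = \sum_j cintegral T (G j).
Proof.
move=> cG; apply/colP => i; rewrite summxE mxE.
under eq_Rintegral do rewrite summxE.
rewrite Rintegral_continuous_sum => [|j]; last first.
  by move/continuous_mxP : (cG j); exact.
by apply: eq_bigr => j _; rewrite mxE.
Qed.

Lemma ler_norm_cintegral g (h : R -> R) :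
  {within I, continuous g} -> {within I, continuous h} ->
  (forall s, I s -> `|g s| <= h s) ->
  `|cintegral T g| <= \int[mu]_(s in I) h s.
Proof.
move=> cg ch gh; apply/mx_norm_leP => [|i j].
  by apply: Rintegral_ge0 => s /gh; exact: le_trans.
rewrite mxE (le_trans (le_normr_Rintegral _ _))//.
  exact: continuous_entry_integrable.
have cgi : {within I, continuous (fun s => g s i ord0)}.
  by move/continuous_mxP : cg; exact.
apply: le_Rintegral => //; [|exact: continuous_integrable|].
  by apply: continuous_integrable => s; apply: cvg_norm; exact: cgi.
by move=> s Is; rewrite (le_trans (ler_mx_norm_entry _ _ _))// gh.
Qed.

Lemma continuous_cintegral (H : R -> R -> 'cV[R]_n) :
  {within I `*` I, continuous (fun p => H p.1 p.2)} ->
  {within I, continuous (fun s => cintegral T (H s))}.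
Proof.
move=> /continuous_mxP cH; apply/continuous_mxP => i j.
apply: subspace_eq_continuous
  (continuous_Rintegral (H := fun s tau => H s tau i ord0) (cH i ord0)) => s _.
by rewrite /from_subspace mxE.
Qed.

End vector_valued.
End integral_on_segment.

(** * Sequences with geometrically decreasing increments *)

Section geometric_convergence.
Context (R : realType) (V : completeNormedModType R) (M q : R).
Hypotheses (M_ge0 : 0 <= M) (q_ge0 : 0 <= q) (q_lt1 : q < 1).

Lemma geometric_dist (u : nat -> V) :
  (forall i, `|u i.+1 - u i| <= M * q ^+ i) ->
  forall i j, `|u (i + j)%N - u i| <= M / (1 - q) * q ^+ i.
Proof.
move=> uM i j.
have q1 : 0 < 1 - q by rewrite subr_gt0.
(* With the factor [1 - q ^+ j] the bound is the exact partial sum of the geometric series, so the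
   induction on [j] closes; the factor is at most 1. *)
suff : `|u (i + j)%N - u i| <= M / (1 - q) * q ^+ i * (1 - q ^+ j).
  move=> /le_trans; apply; rewrite ler_piMr//; last by rewrite gerBl exprn_ge0.
  by rewrite mulr_ge0 ?exprn_ge0// divr_ge0// ltW.
elim: j => [|j IH]; first by rewrite addn0 !subrr normr0 mulr0.
rewrite addnS; apply: le_trans (ler_distD (u (i + j)%N) _ _) _.
apply: le_trans (lerD (uM _) IH) _.
suff -> : M / (1 - q) * q ^+ i * (1 - q ^+ j.+1) =
  M * q ^+ (i + j) + M / (1 - q) * q ^+ i * (1 - q ^+ j) by [].
by rewrite exprD exprS; field; rewrite gt_eqF.
Qed.

(** The telescoping series is dominated in norm by a geometric one, hence converges by completeness.
    The rate is the limit in [j] of [geometric_dist]. *)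
Lemma geometric_cvg (u : nat -> V) :
  (forall i, `|u i.+1 - u i| <= M * q ^+ i) ->
  cvgn u /\ forall i, `|u i - limn u| <= M / (1 - q) * q ^+ i.
Proof.
move=> uM.
have cu : cvgn u.
  have : cvgn (series (telescope u)).
    apply: normed_cvg; apply: (@series_le_cvg _ _ (geometric M q)) => //.
    - by move=> i /=.
    - by move=> i; exact: geometric_ge0.
    - by apply: is_cvg_geometric_series; rewrite ger0_norm.
  move=> cvg_telescope.
  have -> : u = (fun i => u 0%N + series (telescope u) i).
    by apply/funext => i; rewrite -eq_sum_telescope.
  by apply: is_cvgD => //; exact: is_cvg_cst.
split=> // i.
have cui : (fun j => `|u i - u j|) @ \oo --> `|u i - limn u|.
  by apply: cvg_norm; apply: cvgB => //; exact: cvg_cst.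
rewrite -(cvg_lim _ cui)//; apply: limr_le.
  by apply/cvg_ex; eexists; exact: cui.
near=> j; have ij : (i <= j)%N by near: j; exact: nbhs_infty_ge.
by rewrite distrC -(subnKC ij) geometric_dist.
Unshelve. all: by end_near. Qed.

(** The pointwise limit is approached at a rate independent of [s], so the three-epsilon argument
    gives its continuity. *)
Lemma geometric_uniform_limit (X : topologicalType) (A : set X)
    (xs : nat -> X -> V) :
  (forall i, {within A, continuous (xs i)}) ->
  (forall i s, A s -> `|xs i.+1 s - xs i s| <= M * q ^+ i) ->
  exists2 x, {within A, continuous x} &
    forall i s, A s -> `|xs i s - x s| <= M / (1 - q) * q ^+ i.
Proof.
move=> cxs xsM; pose x s := limn (xs ^~ s).
have xsx i s : A s -> `|xs i s - x s| <= M / (1 - q) * q ^+ i.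
  move=> As.
  by have [_] := geometric_cvg (u := xs ^~ s) (fun j => xsM j s As); exact.
exists x => //; apply/subspace_continuousP => s As.
apply/cvgrPdist_le => e e0; have e3 : 0 < e / 3 by rewrite divr_gt0.
have : (M / (1 - q) * q ^+ j) @[j --> \oo] --> (0 : R).
  by apply: cvg_geometric; rewrite ger0_norm.
move=> /cvgrPdist_le /(_ _ e3) near_i; near \oo => i.
have ie : M / (1 - q) * q ^+ i <= e / 3.
  have : `|0 - M / (1 - q) * q ^+ i| <= e / 3 by near: i.
  by rewrite sub0r normrN; apply: le_trans; exact: ler_norm.
move/subspace_continuousP : (cxs i) => /(_ s As) /cvgrPdist_le /(_ _ e3) near_s.
near=> s'.
have As' : A s' by near: s'; exact: withinT.
have H1 : `|xs i s - xs i s'| <= e / 3 by near: s'.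
have H2 := le_trans (xsx i s As) ie.
have H3 := le_trans (xsx i s' As') ie.
rewrite (_ : e = e / 3 + (e / 3 + e / 3)); last by field.
rewrite (le_trans (ler_distD (xs i s) _ _))// lerD//; first by rewrite distrC.
by rewrite (le_trans (ler_distD (xs i s') _ _))// lerD.
Unshelve. all: by end_near. Qed.

End geometric_convergence.

(** * The maximum norm on C([0, T]) and the bound for integral operators *)

Section supremum_norm.
Context (R : realType) (T : R) (T_gt0 : 0 < T).
Notation I := (`[0, T]%classic : set R).

(** A continuous image of a compact set is bounded, so [sup] does not take its default value. *)
Lemma maxT_ub (g : R -> R) s :
  {within I, continuous g} -> I s -> g s <= maxT T g.
Proof.
move=> cg Is; apply: ub_le_sup; last by exists s.
have [M [_ gM]] :=
  compact_bounded (continuous_compact cg (@segment_compact _ 0 T)).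
(* [compact_bounded] provides only bounds strictly above [M]. *)
exists (M + 1) => y gy; apply: le_trans (ler_norm y) _.
by apply: gM => //; rewrite ltrDl.
Qed.

Context (n : nat).
Implicit Types (x y : R -> 'cV[R]_n).

Lemma norm1_ub x s : {within I, continuous x} -> I s -> `|x s| <= norm1 T x.
Proof.
by move=> cx; apply: maxT_ub => r; apply: cvg_norm; exact: cx.
Qed.

Lemma norm1_le x c : (forall s, I s -> `|x s| <= c) -> norm1 T x <= c.
Proof.
move=> xc; apply: ge_sup => [|_ [s Is <-]]; last exact: xc.
by exists `|x 0|, 0 => //=; rewrite in_itv/= lexx ltW.
Qed.

Lemma norm1_ge0 x : {within I, continuous x} -> 0 <= norm1 T x.
Proof.
move=> cx; apply: le_trans (norm1_ub cx (s := 0) _) => //=.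
by rewrite in_itv/= lexx ltW.
Qed.

Lemma eq_norm1 x y : (forall s, I s -> x s = y s) -> norm1 T x = norm1 T y.
Proof.
move=> xy; congr sup; apply/seteqP; split=> _ [s Is <-]; exists s => //.
all: by rewrite xy.
Qed.

Lemma norm1_distC x y :
  norm1 T (fun s => x s - y s) = norm1 T (fun s => y s - x s).
Proof. by congr sup; apply: eq_imagel => s _; rewrite distrC. Qed.

(** The pointwise operator norm bound is integrated in [tau]. The resulting integral is continuous
    in [s], which is what allows bounding it by [maxT]. *)
Lemma ler_norm1_cintegral (D : R -> R -> 'M[R]_n) y :
  {within I `*` I, continuous (fun p => D p.1 p.2)} ->
  {within I, continuous y} ->
  norm1 T (fun s => cintegral T (fun tau => D s tau *m y tau)) <=
    maxT T (fun s => \int[lebesgue_measure]_(tau in `[0, T]) opnorm (D s tau))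
      * norm1 T y.
Proof.
move=> cD cy; apply: norm1_le => s Is.
have cO := continuous_opnorm cD.
have cOs := continuous_slice (H := fun s tau => opnorm (D s tau)) cO Is.
have /le_trans -> // : `|cintegral T (fun tau => D s tau *m y tau)| <=
  \int[lebesgue_measure]_(tau in I) (opnorm (D s tau) * norm1 T y).
  apply: ler_norm_cintegral.
  - by apply: continuous_mulmx cy; exact: continuous_slice.
  - by move=> tau; apply: cvgM; [exact: cOs|exact: cvg_cst].
  - move=> tau Itau; apply: le_trans (ler_opnorm_mulmx _ _) _.
    by rewrite ler_wpM2l ?opnorm_ge0 ?norm1_ub.
rewrite RintegralZr//; last exact: continuous_integrable.
rewrite ler_wpM2r ?norm1_ge0//.
apply: (maxT_ub (g := fun s =>
  \int[lebesgue_measure]_(tau in I) opnorm (D s tau))) => //.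
exact: continuous_Rintegral.
Qed.

End supremum_norm.

(** * Solutions with a general operator: rewriting and differences *)

Section solutions.
Context (R : realType) (n m : nat) (T : R) (T_gt0 : 0 < T).
Context (A : R -> 'M[R]_n) (t : 'I_m.+1 -> R) (B : 'I_m.+1 -> 'M[R]_n).
Implicit Types (f x y : R -> 'cV[R]_n) (d : 'cV[R]_n).
Implicit Types L : (R -> 'cV[R]_n) -> R -> 'cV[R]_n.
Notation I := (`[0, T]%classic : set R).

Lemma solution_with_continuous L f d x :
  solution_with T A t B L f d x -> {within I, continuous x}.
Proof. by case. Qed.

(** Only the sum [L x + f] enters the equation, so terms can move between operator and right-hand
    side. Continuity of [x] is offered to the premise because splitting integrals requires it. *)
Lemma solution_with_eq L L' f f' d x :
  ({within I, continuous x} ->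
    forall s, s \in `]0, T[ -> L x s + f s = L' x s + f' s) ->
  solution_with T A t B L f d x -> solution_with T A t B L' f' d x.
Proof.
move=> LL' [cx dx cdx ode bc]; split=> // s Is.
by rewrite ode// -addrA LL'// addrA.
Qed.

Lemma solution_withB L f1 f2 d1 d2 x1 x2 :
  (forall s, {within I, continuous x1} -> {within I, continuous x2} ->
    s \in `]0, T[ -> L (fun s => x1 s - x2 s) s = L x1 s - L x2 s) ->
  solution_with T A t B L f1 d1 x1 -> solution_with T A t B L f2 d2 x2 ->
  solution_with T A t B L (fun s => f1 s - f2 s) (d1 - d2)
    (fun s => x1 s - x2 s).
Proof.
move=> LB [cx1 dx1 cdx1 ode1 bc1] [cx2 dx2 cdx2 ode2 bc2].
have dB s : s \in `]0, T[ ->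
    derive1 (fun s => x1 s - x2 s) s = derive1 x1 s - derive1 x2 s.
  move=> Is; rewrite !derive1E; apply: deriveB; [exact: dx1|exact: dx2].
split.
- by move=> s; apply: cvgB; [exact: cx1|exact: cx2].
- by move=> s Is; apply: derivableB; [exact: dx1|exact: dx2].
(* The derivative of the difference is known only on the open interval, so continuity is proved for
   the difference of derivatives and transferred along [dB]. *)
- have : {within `]0, T[, continuous (fun s => derive1 x1 s - derive1 x2 s)}.
    by move=> s; apply: cvgB; [exact: cdx1|exact: cdx2].
  by apply: subspace_eq_continuous => s /set_mem Is; exact: esym (dB _ Is).
- move=> s Is; rewrite dB// ode1// ode2// LB// mulmxBr.
  by rewrite opprD addrACA opprD [X in X + _ = _]addrACA.
- rewrite -bc1 -bc2 -sumrB; apply: eq_bigr => i _.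
  by rewrite mulmxBr.
Qed.

End solutions.

(* The library declares both structures on matrices, but not their join
   completeNormedModType. *)
HB.instance Definition _ (R : realType) (p q : nat) := Complete.on 'M[R]_(p, q).

(** The right-hand side tends to 0; this turns estimates valid for all iterates into equality of two
    limits. *)
Lemma geometric_bound_le0 (R : realType) (a c q : R) :
  0 <= q -> q < 1 -> (forall i : nat, a <= c * q ^+ i) -> a <= 0.
Proof.
move=> q_ge0 q_lt1 ac.
have cq : (c * q ^+ i) @[i --> \oo] --> (0 : R).
  by apply: cvg_geometric; rewrite ger0_norm.
rewrite -(cvg_lim _ cq)//; apply: limr_ge; last exact: nearW.
by apply/cvg_ex; eexists; exact: cq.
Qed.

(** * The exact and step problems as perturbations of the approximating problem *)

Section perturbation.
Context (R : realType) (n m k : nat) (T : R) (T_gt0 : 0 < T).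
Context (A : R -> 'M[R]_n) (K : R -> R -> 'M[R]_n).
Context (phi psi : 'I_k -> R -> 'M[R]_n).
Context (t : 'I_m.+1 -> R) (B : 'I_m.+1 -> 'M[R]_n).
Notation I := (`[0, T]%classic : set R).
Hypothesis K_cont : {within I `*` I, continuous (fun p : R * R => K p.1 p.2)}.
Hypothesis phi_cont : forall j, {within I, continuous (phi j)}.
Hypothesis psi_cont : forall j, {within I, continuous (psi j)}.
Implicit Types (f x y : R -> 'cV[R]_n) (d : 'cV[R]_n).

Let D s tau := K s tau - degenerate_kernel phi psi s tau.
Let S y s := cintegral T (fun tau => D s tau *m y tau).

Let D_cont : {within I `*` I, continuous (fun p : R * R => D p.1 p.2)}.
Proof.
have cdeg : {within I `*` I,
    continuous (fun p => degenerate_kernel phi psi p.1 p.2)}.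
  apply: continuous_big => [|j _]; first exact: add_continuous.
  by apply: continuous_mulmx; [exact: continuous_fst|exact: continuous_snd].
by move=> p; apply: cvgB; [exact: K_cont|exact: cdeg].
Qed.

Let kernel_mulmx_cont (H : R -> R -> 'M[R]_n) y s :
  {within I `*` I, continuous (fun p => H p.1 p.2)} ->
  {within I, continuous y} -> I s ->
  {within I, continuous (fun tau => H s tau *m y tau)}.
Proof.
by move=> cH cy Is; apply: continuous_mulmx cy; exact: continuous_slice.
Qed.

Let S_cont y : {within I, continuous y} -> {within I, continuous (S y)}.
Proof.
move=> cy.
apply: (continuous_cintegral T_gt0 (H := fun s tau => D s tau *m y tau)) => //.
by apply: continuous_mulmx; [exact: D_cont|exact: continuous_snd].
Qed.

Let SB x y s : {within I, continuous x} -> {within I, continuous y} -> I s ->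
  S x s - S y s = S (fun s => x s - y s) s.
Proof.
move=> cx cy Is; rewrite -cintegralB; try exact: kernel_mulmx_cont.
by apply: eq_cintegral => tau _; rewrite mulmxBr.
Qed.

Let psi_mulmx_cont (M : 'M[R]_n) j y : {within I, continuous y} ->
  {within I, continuous (fun tau => M *m psi j tau *m y tau)}.
Proof.
move=> cy; apply: continuous_mulmx cy.
by apply: continuous_mulmx (psi_cont (j := j)) => tau; exact: cvg_cst.
Qed.

(** The approximating problem keeps [phi j s] inside the integral and the step problem outside;
    linearity reconciles the two forms. *)
Let degenerate_sum y s : {within I, continuous y} -> I s ->
  \sum_(j < k) cintegral T (fun tau => phi j s *m psi j tau *m y tau) =
  \sum_(j < k) phi j s *m cintegral T (fun tau => psi j tau *m y tau).
Proof.
move=> cy Is; apply: eq_bigr => j _; rewrite -cintegral_mulmx.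
  by apply: eq_cintegral => tau _; rewrite mulmxA.
by apply: continuous_mulmx cy; exact: psi_cont.
Qed.

Let degenerate_integral y s : {within I, continuous y} -> I s ->
  \sum_(j < k) cintegral T (fun tau => phi j s *m psi j tau *m y tau) + S y s =
  cintegral T (fun tau => K s tau *m y tau).
Proof.
move=> cy Is.
rewrite -cintegral_sum => [|j]; last exact: psi_mulmx_cont.
rewrite -cintegralD.
- apply: eq_cintegral => tau _.
  by rewrite -mulmx_suml -mulmxDl addrC subrK.
- apply: continuous_big => [|j _]; first exact: add_continuous.
  exact: psi_mulmx_cont.
- exact: kernel_mulmx_cont.
Qed.

Let oo_subcc s : s \in `]0, T[ -> I s.
Proof. exact: subset_itv_oo_cc. Qed.

(** The previous iterate enters only through the right-hand side, so well-posedness applies to each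
    step. *)
Let stepP f d y x :
  step_solution T A K phi psi t B f d y x <->
  approx_solution T A phi psi t B (fun s => f s + S y s) d x.
Proof.
split; apply: solution_with_eq => cx s /oo_subcc Is; by rewrite degenerate_sum.
Qed.

(** The fixed-point form of the exact problem: degenerate part plus [S x] restores the kernel
    [K]. *)
Let exactP f d x :
  exact_solution T A K t B f d x <-> step_solution T A K phi psi t B f d x x.
Proof.
rewrite stepP; split; apply: solution_with_eq => cx s /oo_subcc Is.
all: by rewrite [_ + (f s + S x s)]addrCA degenerate_integral// addrC.
Qed.

(** * Consequences of well-posedness *)

Section well_posed.
Context (C : R) (n_gt0 : (0 < n)%N).
Hypothesis wp : well_posed T A phi psi t B C.

(** Well-posedness bounds one solution; uniqueness carries the bound to any other. *)
Lemma norm1_approx_solution f d x : {within I, continuous f} ->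
  approx_solution T A phi psi t B f d x ->
  norm1 T x <= C * Num.max (norm1 T f) `|d|.
Proof.
move=> cf fx; have [z [[_ uz] zC]] := wp d cf.
rewrite (eq_norm1 (y := z))// => s Is.
by apply: uz => //; rewrite inE.
Qed.

Lemma well_posed_constant_ge0 : 0 <= C.
Proof.
have c0 : {within I, continuous (fun _ : R => 0 : 'cV[R]_n)}.
  by move=> s; exact: cvg_cst.
(* Zero [f] and the all-ones [d] give data of positive norm, as [n] is positive; [C] times it bounds
   a norm, which forces the sign of [C]. *)
have [x [[fx _] xC]] := wp (const_mx 1) c0.
have := le_trans (norm1_ge0 T_gt0 (solution_with_continuous fx)) xC.
rewrite pmulr_lge0// lt_max; apply/orP; right.
rewrite normr_gt0; apply/eqP => /matrixP /(_ (Ordinal n_gt0) ord0).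
by rewrite !mxE => /eqP; rewrite oner_eq0.
Qed.

(** With a common [d] the difference has zero multipoint data, so the maximum reduces to the norm of
    [f1 - f2]. *)
Lemma approx_solution_dist f1 f2 d x1 x2 :
  {within I, continuous f1} -> {within I, continuous f2} ->
  approx_solution T A phi psi t B f1 d x1 ->
  approx_solution T A phi psi t B f2 d x2 ->
  norm1 T (fun s => x1 s - x2 s) <= C * norm1 T (fun s => f1 s - f2 s).
Proof.
move=> cf1 cf2 fx1 fx2.
have cf : {within I, continuous (fun s => f1 s - f2 s)}.
  by move=> s; apply: cvgB; [exact: cf1|exact: cf2].
have /norm1_approx_solution : approx_solution T A phi psi t B
    (fun s => f1 s - f2 s) (d - d) (fun s => x1 s - x2 s).
  apply: solution_withB fx1 fx2 => s cx1 cx2 /oo_subcc Is.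
  rewrite -sumrB; apply: eq_bigr => j _.
  rewrite -cintegralB; try exact: psi_mulmx_cont.
  by apply: eq_cintegral => tau _; rewrite mulmxBr.
by move=> /(_ cf); rewrite subrr normr0 max_l// norm1_ge0.
Qed.

(** * The contraction, its fixed point and the error estimate *)

Section contraction.
Context (eps : R) (f : R -> 'cV[R]_n) (d : 'cV[R]_n).
Hypothesis kernel_approx : maxT T (fun s =>
  \int[lebesgue_measure]_(tau in `[0, T]) opnorm (D s tau)) <= eps.
Hypothesis f_cont : {within I, continuous f}.
Notation q := (C * eps).
Notation step := (step_solution T A K phi psi t B f d).

Let S_norm1 y : {within I, continuous y} -> norm1 T (S y) <= eps * norm1 T y.
Proof.
move=> cy; apply: le_trans (ler_norm1_cintegral T_gt0 D_cont cy) _.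
by rewrite ler_wpM2r// norm1_ge0.
Qed.

Let fS_cont y : {within I, continuous y} ->
  {within I, continuous (fun s => f s + S y s)}.
Proof. by move=> cy s; apply: cvgD; [exact: f_cont|exact: S_cont]. Qed.

Lemma step_solution_exists y : {within I, continuous y} ->
  exists x, unique_solution T (step y) x.
Proof.
move=> cy; have [x [[fx ux] _]] := wp d (fS_cont cy).
by exists x; split=> [|z /stepP/ux//]; exact/stepP.
Qed.

Lemma step_solution_dist y1 y2 x1 x2 :
  {within I, continuous y1} -> {within I, continuous y2} ->
  step y1 x1 -> step y2 x2 ->
  norm1 T (fun s => x1 s - x2 s) <= q * norm1 T (fun s => y1 s - y2 s).
Proof.
move=> cy1 cy2 /stepP yx1 /stepP yx2.
apply: le_trans (approx_solution_dist (fS_cont cy1) (fS_cont cy2) yx1 yx2) _.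
rewrite -mulrA ler_wpM2l ?well_posed_constant_ge0//.
rewrite (eq_norm1 (y := S (fun s => y1 s - y2 s))) => [|s Is].
  by apply: S_norm1 => s; apply: cvgB; [exact: cy1|exact: cy2].
by rewrite opprD addrACA subrr add0r SB.
Qed.

(** [S] sees only values on [0, T]; needed since the fixed point equation is obtained only there. *)
Lemma eq_step_solution y z x :
  {within I, continuous y} -> (forall s, I s -> y s = z s) ->
  step y x -> step z x.
Proof.
move=> cy yz /stepP yx; apply/stepP; apply: solution_with_eq yx => _ s _.
congr (_ + (_ + _)); apply: eq_cintegral => tau /set_mem Itau.
by rewrite yz.
Qed.

(** The two right-hand sides are [f] and [f + S y], so they differ by [S y] alone. *)
Lemma approx_step_dist x0 y x : {within I, continuous y} ->
  approx_solution T A phi psi t B f d x0 -> step y x ->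
  norm1 T (fun s => x0 s - x s) <= q * norm1 T y.
Proof.
move=> cy fx0 /stepP yx.
apply: le_trans (approx_solution_dist f_cont (fS_cont cy) fx0 yx) _.
rewrite -mulrA ler_wpM2l ?well_posed_constant_ge0//.
rewrite norm1_distC (eq_norm1 (y := S y)); first exact: S_norm1.
by move=> s _; rewrite addrC addKr.
Qed.

(** [eps] is nonnegative because it dominates the maximum of a nonnegative continuous function. *)
Lemma contraction_ge0 : 0 <= q.
Proof.
rewrite mulr_ge0 ?well_posed_constant_ge0//; apply: le_trans kernel_approx.
have O0 : I 0 by rewrite /= in_itv/= lexx ltW.
apply: le_trans (maxT_ub _ O0); last first.
  by apply: (continuous_Rintegral T_gt0 (H := fun s tau => opnorm (D s tau)));
    exact: continuous_opnorm D_cont.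
by apply: Rintegral_ge0 => tau _; exact: opnorm_ge0.
Qed.

Hypothesis q_lt1 : q < 1.
Notation xs_approx := (successive_approximations T A K phi psi t B f d).
Notation exact_f := (exact_solution T A K t B f d).

Lemma successive_approximations_continuous xs :
  xs_approx xs -> forall i, {within I, continuous (xs i)}.
Proof.
case=> -[x0 _] xsS [|i]; first exact: solution_with_continuous x0.
by have [xi _] := xsS i; exact: solution_with_continuous xi.
Qed.

Lemma successive_approximations_exist : exists xs, xs_approx xs.
Proof.
have [x0 [fx0 _]] := wp d f_cont.
have /choice[G GP] : forall y, exists x,
    {within I, continuous y} -> unique_solution T (step y) x.
  (* For discontinuous [y] the implication is vacuous and [y] itself is a dummy witness; the
     iterates never leave the continuous functions. *)
  move=> y; have [cy|ncy] := pselect {within I, continuous y}; last by exists y.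
  by have [x yx] := step_solution_exists cy; exists x.
exists (fun i => iter i G x0); split=> // i; apply: (GP).
elim: i => [|i IH].
  by case: fx0 => fx0 _; exact: solution_with_continuous fx0.
by have [yx _] := GP _ IH; exact: solution_with_continuous yx.
Qed.

Lemma exact_solution_exists : exists x, exact_f x.
Proof.
have [xs xsP] := successive_approximations_exist.
have cxs := successive_approximations_continuous xsP.
have [_ xsS] := xsP; have q_ge0 := contraction_ge0.
(* [M] is the size of the first increment; the contraction scales each later one by [q]. *)
set M := norm1 T (fun s => xs 1%N s - xs 0%N s).
have M_ge0 : 0 <= M.
  by apply: norm1_ge0 => // s; apply: cvgB; exact: cxs.
have xsM i : norm1 T (fun s => xs i.+1 s - xs i s) <= M * q ^+ i.
  elim: i => [|i IH]; first by rewrite mulr1.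
  have [[xi _] [xi1 _]] := (xsS i, xsS i.+1).
  apply: le_trans (step_solution_dist (cxs i.+1) (cxs i) xi1 xi) _.
  by rewrite exprS mulrCA ler_wpM2l.
have cB i : {within I, continuous (fun s => xs i.+1 s - xs i s)}.
  by move=> s; apply: cvgB; exact: cxs.
have [x cx xsx] : exists2 x, {within I, continuous x} &
    forall i s, I s -> `|xs i s - x s| <= M / (1 - q) * q ^+ i.
  apply: geometric_uniform_limit => // i s Is.
  exact: le_trans (norm1_ub (cB i) Is) (xsM i).
have [z [xz _]] := step_solution_exists cx.
have cz := solution_with_continuous xz.
(* Once [x] and its image [z] agree on [0, T], [z] is a step solution for itself, hence exact. *)
exists z; apply/exactP; apply: (eq_step_solution cx _ xz) => s Is.
apply/eqP; rewrite -subr_eq0 -normr_le0.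
(* The iterate of index [i.+1] is inserted between [x] and [z]. Each distance is at most
   [M / (1 - q) * q ^+ i]: one by the uniform rate with a factor [q] dropped, the other by
   contracting the distance from [xs i] to [x]. *)
apply: (@geometric_bound_le0 _ _ (M / (1 - q) + M / (1 - q)) q) => // i.
rewrite mulrDl (le_trans (ler_distD (xs i.+1 s) _ _))// lerD//.
  rewrite distrC (le_trans (xsx _ _ Is))// ler_wpM2l//.
    by rewrite divr_ge0// subr_ge0 ltW.
  by rewrite exprS ler_piMl ?exprn_ge0// ltW.
have [xi1 _] := xsS i.
have cxz : {within I, continuous (fun s => xs i.+1 s - z s)}.
  by move=> r; apply: cvgB; [exact: cxs|exact: cz].
apply: le_trans (norm1_ub cxz Is) _.
apply: le_trans (step_solution_dist (cxs i) cx xi1 xz) _.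
apply: (@le_trans _ _ (norm1 T (fun s => xs i s - x s))).
  rewrite ler_piMl//; last exact: ltW.
  by apply: norm1_ge0 => // r; apply: cvgB; [exact: cxs|exact: cx].
by apply: norm1_le => // r; exact: xsx.
Qed.

Lemma exact_solution_unique x y s : exact_f x -> exact_f y -> I s -> y s = x s.
Proof.
move=> fx fy Is.
have [cx cy] := (solution_with_continuous fx, solution_with_continuous fy).
have cyx : {within I, continuous (fun s => y s - x s)}.
  by move=> r; apply: cvgB; [exact: cy|exact: cx].
have /exactP xx := fx; have /exactP yy := fy.
have := step_solution_dist cy cx yy xx.
(* Two fixed points at distance [a] satisfy [a <= q * a] with [q < 1]. *)
set a := norm1 T _ => aq; have a_le0 : a <= 0 by move: q_lt1; nra.
apply/eqP; rewrite -subr_eq0 -normr_le0.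
exact: le_trans (norm1_ub cyx Is) a_le0.
Qed.

(** The exponent [i.+1] arises because the initial error already carries a factor [q]; every step
    contributes another. *)
Lemma successive_approximations_dist x xs i : exact_f x -> xs_approx xs ->
  norm1 T (fun s => xs i s - x s) <=
    1 / (1 - q) * q ^+ i.+1 * C * Num.max (norm1 T f) `|d|.
Proof.
move=> fx xsP; have cxs := successive_approximations_continuous xsP.
have [[x0 _] xsS] := xsP; have q_ge0 := contraction_ge0.
have cx := solution_with_continuous fx.
have /exactP xx := fx.
have cB j : {within I, continuous (fun s => xs j s - x s)}.
  by move=> s; apply: cvgB; [exact: cxs|exact: cx].
elim: i => [|i IH].
  have H0 := approx_step_dist cx x0 xx.
  have H1 : norm1 T x <= norm1 T (fun s => xs 0%N s - x s) + norm1 T (xs 0%N).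
    apply: norm1_le => // s Is.
    rewrite -(subrK (xs 0%N s) (x s)) (le_trans (ler_normD _ _))// lerD//.
      by rewrite distrC; exact: norm1_ub (cB 0%N) Is.
    exact: norm1_ub.
  have H2 := norm1_approx_solution f_cont x0.
  have q1 : 0 < 1 - q by rewrite subr_gt0.
  set c := Num.max _ _ in H2 *.
  have -> : 1 / (1 - q) * q ^+ 1 * C * c = q * (C * c) / (1 - q).
    by field; rewrite gt_eqF.
  rewrite ler_pdivlMr//.
  (* Substituting [H1] into [H0] and absorbing the error term on the left leaves [(1 - q)] times the
     initial error. *)
  apply: (@le_trans _ _ (q * norm1 T (xs 0%N))).
    rewrite mulrBr mulr1 lerBlDr (le_trans H0)// [X in _ + X]mulrC -mulrDr.
    by rewrite ler_wpM2l// addrC.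
  by rewrite ler_wpM2l.
have [xi _] := xsS i.
apply: le_trans (step_solution_dist (cxs i) cx xi xx) _.
apply: le_trans (ler_wpM2l q_ge0 IH) _.
rewrite [q ^+ i.+2]exprS; move: (1 / (1 - q)) (q ^+ i.+1) => r p.
by rewrite le_eqVlt; apply/orP; left; apply/eqP; ring.
Qed.

End contraction.
End well_posed.
End perturbation.

Theorem theorem4p1 (R : realType) (T : R) (n m k : nat)
  (T_gt0 : 0 < T) (n_ge1 : (1 <= n)%N) (m_ge1 : (1 <= m)%N) (k_ge1 : (1 <= k)%N)
  (t : 'I_m.+1 -> R)
  (t_first : t ord0 = 0) (t_last : t ord_max = T)
  (t_incr : forall i j : 'I_m.+1, (i < j)%N -> t i < t j)
  (A : R -> 'M[R]_n) (A_cont : {within `[0, T], continuous A})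
  (K : R -> R -> 'M[R]_n)
  (K_cont : {within `[0, T]%classic `*` `[0, T]%classic,
               continuous (fun p : R * R => K p.1 p.2)})
  (B : 'I_m.+1 -> 'M[R]_n)
  (f : R -> 'cV[R]_n) (f_cont : {within `[0, T], continuous f})
  (d : 'cV[R]_n)
  (eps : R) (eps_gt0 : 0 < eps)
  (phi psi : 'I_k -> R -> 'M[R]_n)
  (phi_cont : forall j, {within `[0, T], continuous (phi j)})
  (psi_cont : forall j, {within `[0, T], continuous (psi j)})
  (kernel_approx :
     maxT T (fun s => \int[lebesgue_measure]_(tau in `[0, T])
                         opnorm (K s tau - \sum_(j < k) phi j s *m psi j tau))
       < eps)
  (C : R) (P_eps_well_posed : well_posed T A phi psi t B C)
  (q_lt1 : C * eps < 1) :
  exists xstar : R -> 'cV[R]_n,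
    [/\ unique_solution T (exact_solution T A K t B f d) xstar,
        exists xs, successive_approximations T A K phi psi t B f d xs &
        forall xs, successive_approximations T A K phi psi t B f d xs ->
          (fun i => norm1 T (fun s => xs i s - xstar s)) @ \oo --> (0 : R) /\
          forall i : nat, (1 <= i)%N ->
            norm1 T (fun s => xstar s - xs i s)
              <= 1 / (1 - C * eps) * (C * eps) ^+ i
                 * C * Num.max (norm1 T f) `|d|].
Proof.
have wp := P_eps_well_posed; have q_le := ltW kernel_approx.
have q_ge0 := contraction_ge0 T_gt0 K_cont phi_cont psi_cont n_ge1 wp q_le.
have C_ge0 := well_posed_constant_ge0 T_gt0 n_ge1 wp.
have [x fx] := exact_solution_exists T_gt0 K_cont phi_cont psi_cont
  n_ge1 wp d q_le f_cont q_lt1.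
exists x; split.
- split=> // y fy s Is.
  exact: (exact_solution_unique T_gt0 K_cont phi_cont psi_cont
    n_ge1 wp q_le f_cont q_lt1 fx fy).
- exact: (successive_approximations_exist T_gt0 K_cont phi_cont psi_cont
    wp d f_cont).
move=> xs xsP.
(* The available exponent is [i.+1]; as [q] lies in [0, 1), one factor is dropped to reach the
   stated form. *)
have dist i : norm1 T (fun s => xs i s - x s) <=
    1 / (1 - C * eps) * (C * eps) ^+ i * C * Num.max (norm1 T f) `|d|.
  apply: le_trans (successive_approximations_dist T_gt0 K_cont phi_cont psi_cont
    n_ge1 wp q_le f_cont q_lt1 i fx xsP) _.
  rewrite ler_wpM2r ?le_max ?normr_ge0 ?orbT// ler_wpM2r//.
  rewrite ler_wpM2l ?divr_ge0 ?subr_ge0 ?(ltW q_lt1)//.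
  by rewrite exprS ler_piMl ?exprn_ge0// ltW.
split=> [|i _]; last by rewrite norm1_distC.
(* The same bound, reordered as a constant times a power, squeezes the error to 0. *)
have cqi : (1 / (1 - C * eps) * C * Num.max (norm1 T f) `|d| * (C * eps) ^+ i)
    @[i --> \oo] --> (0 : R).
  by apply: cvg_geometric; rewrite ger0_norm.
apply: squeeze_cvgr cqi; last exact: cvg_cst.
have cxs := successive_approximations_continuous xsP.
have cx := solution_with_continuous fx.
apply: nearW => i; apply/andP; split.
  by apply: norm1_ge0 => // s; apply: cvgB; [exact: cxs|exact: cx].
apply: le_trans (dist i) _.
by rewrite /geometric/= [leRHS]mulrAC [X in _ <= X * _]mulrAC.
Qed.
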